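(* There is a sentence of low rank MSO (over vertex-colored graphs) that cannot be expressed in flip-connectivity logic, i.e., no sentence of flip-connectivity logic is equivalent to it on all vertex-colored graphs.
   Context: Graphs are finite, simple, undirected, vertex-colored (finitely many unary predicates). For $X\subseteq V(G)$, $\mathrm{rk}(X)$ is the rank over $\mathbb F_2$ of the bipartite adjacency matrix between $X$ and $V(G)\setminus X$. Low rank MSO: MSO over graphs in which every set quantifier is of the form $\exists X\colon r$ / $\forall X\colon r$, ranging only over vertex sets of rank at most $r$; otherwise vertex quantifiers, Boolean connectives, $E(x,y)$, $x=y$, unary predicates, $x\in X$. The atomic type $\mathrm{atp}(v_1,\dots,v_k)$ of a tuple of vertices is the set of atomic formulas of the forms $x_i=x_j$, $E(x_i,x_j)$, $U(x_i)$ ($U$ a unary predicate) satisfied by the tuple; $\mathrm{atp}^k$ is the (finite) set of all possible atomic types of $k$-tuples. For $A\subseteq \mathrm{atp}^{k+1}\times\mathrm{atp}^{k+1}$ and $\bar a\in V(G)^k$, the flip $G\oplus_{\bar a}A$ is the directed graph on $V(G)$ in which, for distinct $u,v$, $\vec{uv}$ is an arc iff $[uv\in E(G)]$ xor $[(\mathrm{atp}(u,\bar a),\mathrm{atp}(v,\bar a))\in A]$. If $A$ is symmetric, the flip is regarded as an undirected graph. Flip-connectivity logic is first-order logic over graphs extended by predicates $\mathrm{flipconn}_{k,A}(s,t,a_1,\dots,a_k)$ for every $k$ and symmetric $A\subseteq\mathrm{atp}^{k+1}\times\mathrm{atp}^{k+1}$, holding iff $s$ and $t$ lie in the same connected component of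 $G\oplus_{(a_1,\dots,a_k)}A$. *)

(* Defs.v *)
From HB Require Import structures.
From mathcomp Require Import all_boot all_order all_algebra.
Set Implicit Arguments.
Unset Strict Implicit.
Unset Printing Implicit Defensive.

Record cgraph (U : finType) := CGraph {
  vertex :> finType;
  adj : rel vertex;
  color : U -> pred vertex;
  adj_sym : symmetric adj;
  adj_irr : irreflexive adj
}.

Definition cut_mx (U : finType) (G : cgraph U) (X : {set G}) :
    'M['F_2]_(#|X|, #|~: X|) :=
  (\matrix_(i, j) (adj (enum_val i) (enum_val j))%:R)%R.

Definition cut_rank (U : finType) (G : cgraph U) (X : {set G}) : nat :=
  \rank (cut_mx X).

(* Formulas are well-scoped: [lrmso U n m] has its free vertex variables in
   ['I_n] and its free set variables in ['I_m]; a quantifier binds variable 0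
   and shifts the others. Sentences have n = m = 0. *)
Inductive lrmso (U : finType) : nat -> nat -> Type :=
| LEq n m (x y : 'I_n) : lrmso U n m
| LAdj n m (x y : 'I_n) : lrmso U n m
| LCol n m (u : U) (x : 'I_n) : lrmso U n m
| LMem n m (x : 'I_n) (X : 'I_m) : lrmso U n m
| LNot n m (f : lrmso U n m) : lrmso U n m
| LAnd n m (f g : lrmso U n m) : lrmso U n m
| LOr n m (f g : lrmso U n m) : lrmso U n m
| LEx n m (f : lrmso U n.+1 m) : lrmso U n m
| LAll n m (f : lrmso U n.+1 m) : lrmso U n m
| LExSet n m (r : nat) (f : lrmso U n m.+1) : lrmso U n m
| LAllSet n m (r : nat) (f : lrmso U n m.+1) : lrmso U n m.

Fixpoint lrmso_sat (U : finType) (G : cgraph U) (n m : nat)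
    (f : lrmso U n m) : n.-tuple G -> m.-tuple {set G} -> bool :=
  match f in lrmso _ n m return n.-tuple G -> m.-tuple {set G} -> bool with
  | LEq _ _ x y => fun e _ => tnth e x == tnth e y
  | LAdj _ _ x y => fun e _ => adj (tnth e x) (tnth e y)
  | LCol _ _ u x => fun e _ => color u (tnth e x)
  | LMem _ _ x X => fun e s => tnth e x \in tnth s X
  | LNot _ _ f => fun e s => ~~ lrmso_sat f e s
  | LAnd _ _ f g => fun e s => lrmso_sat f e s && lrmso_sat g e s
  | LOr _ _ f g => fun e s => lrmso_sat f e s || lrmso_sat g e s
  | LEx _ _ f => fun e s => [exists v : G, lrmso_sat f [tuple of v :: e] s]
  | LAll _ _ f => fun e s => [forall v : G, lrmso_sat f [tuple of v :: e] s]
  | LExSet _ _ r f => fun e s =>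
      [exists X : {set G},
         (cut_rank X <= r) && lrmso_sat f e [tuple of X :: s]]
  | LAllSet _ _ r f => fun e s =>
      [forall X : {set G},
         (cut_rank X <= r) ==> lrmso_sat f e [tuple of X :: s]]
  end.

(* Atomic formulas over k variables: x_i = x_j (left-left),
   E(x_i, x_j) (left-right) and U(x_i) (right). *)
Definition atom (U : finType) (k : nat) : finType :=
  (('I_k * 'I_k) + ('I_k * 'I_k) + (U * 'I_k))%type.

Definition atom_sat (U : finType) (G : cgraph U) (k : nat) (v : k.-tuple G)
    (a : atom U k) : bool :=
  match a with
  | inl (inl (i, j)) => tnth v i == tnth v j
  | inl (inr (i, j)) => adj (tnth v i) (tnth v j)
  | inr (u, i) => color u (tnth v i)
  end.

Definition atp (U : finType) (G : cgraph U) (k : nat) (v : k.-tuple G) :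
  {set atom U k} := [set a | atom_sat v a].

Definition possible_atp (U : finType) (k : nat) (t : {set atom U k}) : Prop :=
  exists (G : cgraph U) (v : k.-tuple G), t = atp v.

Record flip_spec (U : finType) (k : nat) := FlipSpec {
  flip_set :> {set {set atom U k.+1} * {set atom U k.+1}};
  flip_possible : forall p q, (p, q) \in flip_set ->
    possible_atp p /\ possible_atp q;
  flip_sym : forall p q, (p, q) \in flip_set -> (q, p) \in flip_set
}.

Definition flip (U : finType) (G : cgraph U) (k : nat)
    (A : {set {set atom U k.+1} * {set atom U k.+1}}) (a : k.-tuple G) :
    rel G :=
  fun u v => (u != v) &&
    (adj u v (+) ((atp [tuple of u :: a], atp [tuple of v :: a]) \in A)).

(* The free variables of [flogic U n] are in ['I_n], as for [lrmso]. *)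
Inductive flogic (U : finType) : nat -> Type :=
| FEq n (x y : 'I_n) : flogic U n
| FAdj n (x y : 'I_n) : flogic U n
| FCol n (u : U) (x : 'I_n) : flogic U n
| FConn n (k : nat) (A : flip_spec U k) (s t : 'I_n) (a : k.-tuple 'I_n) :
    flogic U n
| FNot n (f : flogic U n) : flogic U n
| FAnd n (f g : flogic U n) : flogic U n
| FOr n (f g : flogic U n) : flogic U n
| FEx n (f : flogic U n.+1) : flogic U n
| FAll n (f : flogic U n.+1) : flogic U n.

(* [A] is symmetric in [FConn], so the flip is an undirected graph and
   [connect] is membership in the same connected component. *)
Fixpoint flogic_sat (U : finType) (G : cgraph U) (n : nat)
    (f : flogic U n) : n.-tuple G -> bool :=
  match f in flogic _ n return n.-tuple G -> bool with
  | FEq _ x y => fun e => tnth e x == tnth e y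
  | FAdj _ x y => fun e => adj (tnth e x) (tnth e y)
  | FCol _ u x => fun e => color u (tnth e x)
  | FConn _ _ A s t a => fun e =>
      connect (flip A [tuple of map (tnth e) a]) (tnth e s) (tnth e t)
  | FNot _ f => fun e => ~~ flogic_sat f e
  | FAnd _ f g => fun e => flogic_sat f e && flogic_sat g e
  | FOr _ f g => fun e => flogic_sat f e || flogic_sat g e
  | FEx _ f => fun e => [exists v : G, flogic_sat f [tuple of v :: e]]
  | FAll _ f => fun e => [forall v : G, flogic_sat f [tuple of v :: e]]
  end.

Definition lrmso_sentence (U : finType) := lrmso U 0 0.
Definition flogic_sentence (U : finType) := flogic U 0.

Definition lrmso_models (U : finType) (G : cgraph U) (f : lrmso_sentence U) :
  bool := lrmso_sat f [tuple of [::] : seq G] [tuple of [::] : seq {set G}].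

Definition flogic_models (U : finType) (G : cgraph U)
    (f : flogic_sentence U) : bool :=
  flogic_sat f [tuple of [::] : seq G].

(* Main.v *)
(* The proof compares two graphs that differ by a twist. Both have core vertices
   in two colors P and Q, each split into two sheets, and two uncolored ladders
   attached to P at both ends: without the twist each ladder stays in one sheet,
   with the twist it joins the two sheets of P. Orient P-Q pairs from P to Q if
   adjacent and from Q to P otherwise. Each sheet of the core is strongly
   connected, and all pairs between the sheets point the same way. So a set
   of rank 1 that is not left by any ladder edge nor by the reversed orientation
   separates P only in the untwisted graph, which low rank MSO can say.

   Labels are chosen so that, for any few vertices, some label is fresh: fresh
   vertices of the same color have the same atomic type over these vertices,
   even when they lie in different sheets. Hence an undirected flip cannot
   separate the sheets, and it keeps all ladder vertices far from the parameters
   connected through fresh vertices. The twist may therefore be moved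
   along the ladders to any place free of pebbles, and Duplicator wins the
   game by halving the pebble-free interval where it is hidden. *)

Require Import Defs.
From mathcomp Require Import all_boot all_order all_algebra.
From mathcomp Require Import zify.
Set Implicit Arguments.
Unset Strict Implicit.
Unset Printing Implicit Defensive.

(** * Paths, tuples and atomic types *)

Lemma exists_notin (T : finType) (s : seq T) :
  size s < #|T| -> exists x, x \notin s.
Proof.
move=> lt_sT; apply/existsP; rewrite -negb_forall; apply: contraL lt_sT.
move=> /forallP s_all; rewrite -leqNgt cardE.
by apply: uniq_leq_size (enum_uniq _) _ => x _; apply: s_all.
Qed.

Lemma connect_transfer (T T' : finType) (e : rel T) (e' : rel T')
    (f : T -> T') :
    (forall x y, e x y -> connect e' (f x) (f y)) ->
  forall x y, connect e x y -> connect e' (f x) (f y).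
Proof.
move=> ef x y /connectP[p]; elim: p x => [|z p IHp] x /=.
  by move=> _ ->; apply: connect0.
case/andP=> exz pth_p def_y.
by apply: connect_trans (ef _ _ exz) (IHp _ pth_p def_y).
Qed.

Lemma flip_symmetric (U : finType) (G : cgraph U) (k : nat)
  (A : flip_spec U k) (a : k.-tuple G) : symmetric (flip A a).
Proof.
move=> u v; rewrite /flip eq_sym adj_sym; congr (_ && (_ (+) _)).
by apply/idP/idP => /flip_sym.
Qed.

Lemma tnth_cons_cases (T : Type) (k : nat) (x : T) (a : k.-tuple T)
    (i : 'I_k.+1) :
  tnth [tuple of x :: a] i = x \/ exists j, tnth [tuple of x :: a] i = tnth a j.
Proof.
case: (unliftP ord0 i) => [j|] ->; [right; exists j; exact: tnthS | left].
exact: tnth0.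
Qed.

Lemma atp_cons_eq (U : finType) (G : cgraph U) (k : nat) (u v : G)
    (a : k.-tuple G) :
    (forall q : U, color q u = color q v) ->
    (forall i, (u == tnth a i) = (v == tnth a i)) ->
    (forall i, adj u (tnth a i) = adj v (tnth a i)) ->
  atp [tuple of u :: a] = atp [tuple of v :: a].
Proof.
move=> eq_col eq_eq eq_adj; apply/setP=> -[[[i j]|[i j]]|[q i]]; rewrite !inE /=.
- case: (unliftP ord0 i) => [i'|] ->; case: (unliftP ord0 j) => [j'|] ->;
    by rewrite ?tnthS ?tnth0 ?eqxx // eq_sym eq_eq eq_sym.
- case: (unliftP ord0 i) => [i'|] ->; case: (unliftP ord0 j) => [j'|] ->;
    by rewrite ?tnthS ?tnth0 ?adj_irr // adj_sym eq_adj adj_sym.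
- by case: (unliftP ord0 i) => [i'|] ->; rewrite ?tnthS ?tnth0.
Qed.

Lemma map_cons_tuple (T T' : Type) (f : T -> T') (k : nat) (x : T)
    (a : k.-tuple T) :
  [tuple of map f [tuple of x :: a]] = [tuple of f x :: [tuple of map f a]].
Proof. exact: val_inj. Qed.

Lemma atp_map (U : finType) (G G' : cgraph U) (f : G -> G') (k : nat)
    (a : k.-tuple G) :
    injective f -> (forall (q : U) v, color q (f v) = color q v) ->
    (forall i j, adj (f (tnth a i)) (f (tnth a j)) = adj (tnth a i) (tnth a j)) ->
  atp [tuple of map f a] = atp a.
Proof.
move=> f_inj f_col f_adj; apply/setP => -[[[i j]|[i j]]|[q i]];
  rewrite !inE /= !tnth_map //.
exact: inj_eq.
Qed.

(* A pebble-free interval of length [cost f] hides the twist from [f]; it also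
   bounds the number of parameters of each flip in [f]. *)
Fixpoint cost (U : finType) (n : nat) (f : flogic U n) : nat :=
  match f with
  | FConn _ k _ _ _ _ => k + 4
  | FNot _ f => cost f
  | FAnd _ f g | FOr _ f g => maxn (cost f) (cost g)
  | FEx _ f | FAll _ f => (cost f).*2.+1
  | _ => 4
  end.

(** A gap from [lo] to [hi] holds a place [m] with [lo < m] and [m.+2 < hi] only if its length is at
    least 4. *)
Lemma cost_ge4 (U : finType) (n : nat) (f : flogic U n) : 4 <= cost f.
Proof. by elim: f => //= *; lia. Qed.

(** * The ladder graphs *)

Section TwistedLadder.

Variable M : nat.

(* A vertex is a place (position on a ladder, or color: [true] for P, [false]
   for Q), a sheet and a label [(z, t)]. Of a core vertex only [t] matters for P
   and only [z] for Q in the P-Q adjacency: [M + 1] entries [z] can be listed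
   in one [t], while no [M + 1] lists [t] cover all [z]. *)
Definition width := M.+2 * M.+2.
Definition label : finType := ('I_width * (M.+1).-tuple 'I_width)%type.
Definition ladder_vertex : finType := (('I_M.+2 + bool) * bool * label)%type.

Implicit Types (u v w : ladder_vertex) (p q : label) (c x y : bool).

(** Any label turns into any other in two changes of one coordinate, whereas a fresh label shares no
    coordinate with a parameter. *)
Definition share p q := (p.1 == q.1) || (p.2 == q.2).

Definition kind u : option bool :=
  if u.1.1 is inr b then Some b else None.

(** The twist [c] sits at the far attachment to P. P-Q pairs across sheets all point from sheet
    [false] to sheet [true]. *)
Definition arc c u v : bool :=
  let: (k, x, p) := u in let: (l, y, q) := v in
  match k, l with
  | inl i, inl j => [&& x == y, j == i.+1 :> nat & share p q]
  | inl i, inr true =>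
      (((i == 0 :> nat) && (x == y)) || ((i == M.+1 :> nat) && (x (+) c == y)))
      && (p.1 == q.1)
  | inr true, inr false => if x == y then (q.1 \notin p.2) (+) x else ~~ x
  | _, _ => false
  end.

Definition ladder_adj c : rel ladder_vertex := fun u v => arc c u v || arc c v u.

Lemma ladder_adj_sym c : symmetric (ladder_adj c).
Proof. by move=> u v; rewrite /ladder_adj orbC. Qed.

Lemma ladder_adj_irr c : irreflexive (ladder_adj c).
Proof.
case=> [[[i|[]] x] p]; rewrite /ladder_adj orbb //=.
by apply/negP => /and3P[_ /eqP]; lia.
Qed.

Definition ladder c : cgraph bool :=
  CGraph (fun b u => kind u == Some b)
    (@ladder_adj_sym c) (@ladder_adj_irr c).

(** * Moving the twist along the ladders *)

Definition swap (m : nat) u : ladder_vertex :=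
  if u is (inl i, x, p) then (inl i, x (+) (m < i), p) else u.

Definition near (m : nat) u : bool :=
  if u.1.1 is inl i then (i == m :> nat) || (i == m.+1 :> nat) else false.

Definition outside (lo hi : nat) u : bool :=
  if u.1.1 is inl i then ~~ (lo <= i < hi) else true.

Lemma swapK m : involutive (swap m).
Proof. by case=> [[[i|b] x] p] //=; rewrite addbK. Qed.

Lemma kind_swap m u : kind (swap m u) = kind u.
Proof. by case: u => [[[i|b] x] p]. Qed.

Lemma near_swap m m' u : near m (swap m' u) = near m u.
Proof. by case: u => [[[i|b] x] p]. Qed.

Lemma outside_swap m lo hi u : outside lo hi (swap m u) = outside lo hi u.
Proof. by case: u => [[[i|b] x] p]. Qed.

Lemma swap_outside lo hi m m' u :
    lo <= m.+1 -> m < hi -> lo <= m'.+1 -> m' < hi -> outside lo hi u ->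
  swap m u = swap m' u.
Proof.
case: u => [[[i|b] x] p] //= lo_m m_hi lo_m' m'_hi; rewrite /outside /= => out.
by congr (_, _ (+) _, _); lia.
Qed.

Lemma outside_near lo hi m u :
  lo <= m -> m.+1 < hi -> outside lo hi u -> near m u = false.
Proof.
case: u => [[[i|b] x] p] //= lo_m m_hi; rewrite /outside /near /=.
by lia.
Qed.

(** Beyond place [m] both ends of a rung change sheet, and at the last position this change absorbs
    the negation of [c]; only rungs between [m] and [m.+1] break. *)
Lemma arc_swap c m u v : m < M.+1 -> ~~ (near m u && near m v) ->
  arc (~~ c) (swap m u) (swap m v) = arc c u v.
Proof.
move=> m_lt; case: u v => [[[i|[]] x] p] [[[j|[]] y] q] //=; rewrite /near /=.
- move=> not_near; case: (j =P i.+1 :> nat) => [ij|_]; last by rewrite !andbF.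
  suff -> : (m < i) = (m < j) by rewrite (can_eq (addbK _)).
  by lia.
- move=> _; case: (altP (i =P 0 :> nat)) => [->|i0] /=.
    by rewrite addbF eq_sym.
  case: (altP (i =P M.+1 :> nat)) => [->|//] /=.
  by rewrite m_lt addbT; case: x y c => [] [] [].
Qed.

Lemma ladder_adj_swap c m u v : m < M.+1 -> ~~ (near m u && near m v) ->
  ladder_adj (~~ c) (swap m u) (swap m v) = ladder_adj c u v.
Proof.
by move=> m_lt nuv; rewrite /ladder_adj !arc_swap // andbC.
Qed.

(** * Fresh labels and typical vertices *)

Definition fresh_label (k : nat) (a : k.-tuple ladder_vertex) p : bool :=
  (p.1 \in p.2) &&
  all (fun v => [&& p.1 != v.2.1, p.1 \notin v.2.2 & v.2.1 \in p.2]) a.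

(** The parameters carry [k * M.+2] label entries, fewer than [width], so some [x] avoids them all;
    the new list has room for [x] and the [k] first coordinates. *)
Lemma fresh_label_exists (k : nat) (a : k.-tuple ladder_vertex) :
  k <= M -> exists p, fresh_label a p.
Proof.
move=> le_kM.
pose s := flatten [seq v.2.1 :: v.2.2 | v : ladder_vertex <- a].
have size_s : size s = k * M.+2.
  rewrite size_flatten /shape -map_comp -[in RHS](size_tuple a).
  rewrite (eq_map (g := fun=> M.+2)); last by move=> v /=; rewrite size_tuple.
  by elim: (tval a) => //= v t ->; rewrite mulSn.
have /exists_notin[x] : size s < #|'I_width|.
  by rewrite size_s card_ord /width; nia.
move=> xs; pose t := x :: [seq v.2.1 | v : ladder_vertex <- a].
have t_in z : z \in t -> z \in [tuple nth x t i | i < M.+1].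
  move=> zt; apply/mapP; have lt_z := zt; rewrite -index_mem in lt_z.
  have lt_zM : index z t < M.+1.
    by apply: leq_trans lt_z _; rewrite /= size_map size_tuple.
  by exists (Ordinal lt_zM); rewrite ?mem_enum //= nth_index.
exists (x, [tuple nth x t i | i < M.+1]); apply/andP; split.
  by apply: t_in; apply: mem_head.
apply/allP => v va /=; rewrite t_in ?andbT; last first.
  by rewrite inE; apply/orP; right; apply/mapP; exists v.
have : x \notin v.2.1 :: v.2.2.
  apply: contra xs => xv; apply/flattenP; exists (v.2.1 :: val v.2.2) => //.
  by apply/mapP; exists v.
by rewrite inE negb_or.
Qed.

(* The adjacency to [v] of a fresh vertex of color [b]; the value depends on
   the sheet of [v] but not on that of the fresh vertex. *)
Definition profile (b : option bool) v : bool :=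
  match b, v.1.1 with
  | Some true, inr false => v.1.2
  | Some false, inr true => ~~ v.1.2
  | _, _ => false
  end.

Definition typical c (k : nat) (a : k.-tuple ladder_vertex) u : Prop :=
  forall i, u != tnth a i /\ ladder_adj c u (tnth a i) = profile (kind u) (tnth a i).

(** The memberships imposed on [p] give same-sheet P-Q pairs the adjacency of cross-sheet pairs, so
    the sheet [x] drops out. *)
Lemma typical_fresh c (k : nat) (a : k.-tuple ladder_vertex) p :
  fresh_label a p -> forall (l : 'I_M.+2 + bool) x, typical c a (l, x, p).
Proof.
case/andP=> pp /allP fresh_p l x i.
have := fresh_p _ (mem_tnth i a).
case: (tnth a i) => [[j y] q] /= /and3P[neq1 notin1 in1]; split.
  by apply: contraNneq neq1 => -[_ _ ->].
have neq2 : p.2 != q.2 by apply: contraNneq notin1 => <-.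
rewrite /ladder_adj /profile /kind /= /share.
rewrite ![q.1 == _]eq_sym ![q.2 == _]eq_sym (negPf neq1) (negPf neq2) in1 notin1.
case: l => [l|[]]; case: j => [j|[]]; rewrite /= ?andbF ?orbF //=.
  by case: x; case: y.
by case: x; case: y; rewrite ?pp.
Qed.

Lemma typical_gap c lo hi (k : nat) (a : k.-tuple ladder_vertex)
    (i : 'I_M.+2) x p :
    0 < lo -> hi <= M.+1 -> lo < i -> i.+1 < hi ->
    (forall j, outside lo hi (tnth a j)) ->
  typical c a (inl i, x, p).
Proof.
move=> lo_gt0 hi_le lo_i i_hi out j; have := out j.
case: (tnth a j) => [[[l|[]] y] q]; rewrite /outside /ladder_adj /= => out_l.
- split; first by apply/negP => /eqP[il _ _]; move: out_l; rewrite -il; lia.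
  rewrite /profile /=; apply/negP => /orP[]/and3P[_ /eqP]; lia.
- split=> //; rewrite orbF (_ : (i == 0 :> nat) = false); last by lia.
  by rewrite (_ : (i == M.+1 :> nat) = false) //; lia.
- by split.
Qed.

(** * Connectivity of flips *)

Section Hub.

Variables (c : bool) (k : nat) (A : flip_spec bool k).
Variable a : k.-tuple (ladder c).
Variable p : label.
Hypothesis fresh_p : fresh_label a p.

Let fresh_rep (b : option bool) : ladder c :=
  if b is Some q then (inr q, false, p) else (inl ord0, false, p).

Let tp b := atp [tuple of fresh_rep b :: a].

Let kind_fresh_rep b : kind (fresh_rep b) = b.
Proof. by case: b. Qed.

Let atp_typical u : typical c a u -> atp [tuple of (u : ladder c) :: a] = tp (kind u).
Proof.
move=> typ_u; have typ_r : typical c a (fresh_rep (kind u)).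
  by rewrite /fresh_rep; case: (kind u) => [b|]; apply: typical_fresh.
apply: atp_cons_eq => [q|i|i] /=; first by rewrite kind_fresh_rep.
- by case: (typ_u i) (typ_r i) => /negPf-> _ [/negPf-> _].
- by case: (typ_u i) (typ_r i) => _ -> [_ ->]; rewrite kind_fresh_rep.
Qed.

Let flip_typical u v : typical c a u -> typical c a v ->
  flip A a u v =
    (u != v) && (ladder_adj c u v (+) ((tp (kind u), tp (kind v)) \in A)).
Proof. by move=> typ_u typ_v; rewrite /flip !atp_typical. Qed.

Let flip_connect_sym := sym_connect_sym (flip_symmetric A a).

Let flip_edge u v : typical c a u -> typical c a v -> u != v ->
    ladder_adj c u v (+) ((tp (kind u), tp (kind v)) \in A) ->
  connect (flip A a) (u : ladder c) v.
Proof.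
by move=> typ_u typ_v neq_uv uv; rewrite connect1 // flip_typical ?neq_uv.
Qed.

Let flip_edge_fresh l x l' x' :
    (l, x, p) != (l', x', p) :> ladder_vertex ->
    ladder_adj c (l, x, p) (l', x', p)
      (+) ((tp (kind (l, x, p)), tp (kind (l', x', p))) \in A) ->
  connect (flip A a) ((l, x, p) : ladder c) (l', x', p).
Proof. by apply: flip_edge; apply: typical_fresh. Qed.

Let rung_connect (i : nat) (lt_i : i < M.+2) x :
  (tp None, tp None) \notin A ->
  connect (flip A a) ((inl (Ordinal lt_i), x, p) : ladder c) (inl ord0, x, p).
Proof.
move=> notA; elim: i lt_i => [|i IHi] lt_i.
  by rewrite (_ : Ordinal lt_i = ord0) //; apply: val_inj.
apply: connect_trans (IHi (ltnW lt_i)).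
apply: flip_edge_fresh.
  by apply/eqP => -[]; lia.
by rewrite /kind /= (negPf notA) addbF /ladder_adj /= /share !eqxx !orbT.
Qed.

Let core_connect x :
  connect (flip A a) ((inr true, x, p) : ladder c) (inr true, false, p).
Proof.
case/andP: fresh_p => pp _; case: x; last exact: connect0.
(* If [A] does not flip P-P pairs, a fresh Q vertex is joined to both ends: in sheet [false] if [A]
   flips P-Q pairs, in sheet [true] otherwise. *)
have [inPP|notPP] := boolP ((tp (Some true), tp (Some true)) \in A).
  by apply: flip_edge_fresh => //; rewrite /kind //= inPP.
have [inPQ|notPQ] := boolP ((tp (Some true), tp (Some false)) \in A).
  apply: (@connect_trans _ _ (inr false, false, p)); last rewrite flip_connect_sym.
    by apply: flip_edge_fresh => //; rewrite /kind //= inPQ.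
  by apply: flip_edge_fresh => //; rewrite /kind //= inPQ /ladder_adj /= pp.
apply: (@connect_trans _ _ (inr false, true, p)); last rewrite flip_connect_sym.
  apply: flip_edge_fresh => //; rewrite /kind //= (negPf notPQ).
  by rewrite /ladder_adj /= pp.
by apply: flip_edge_fresh => //; rewrite /kind //= (negPf notPQ).
Qed.

(** If [A] flips ladder-ladder or ladder-P pairs, a fresh ladder or P vertex is a hub. Otherwise
    ladder edges between typical vertices survive and lead, at label [p], to a fresh P vertex, and
    the core joins the sheets. *)
Lemma gap_hub lo hi m :
    0 < lo -> lo < m -> m.+2 < hi -> hi <= M.+1 ->
    (forall j, outside lo hi (tnth a j)) ->
  exists h, forall u, near m u -> connect (flip A a) (u : ladder c) h.
Proof.
move=> lo_gt0 lo_m m_hi hi_le out.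
have typ_near u : near m u -> typical c a u.
  case: u => [[[i|b] x] q] //; rewrite /near /= => near_i.
  by apply: typical_gap out => //; lia.
have [inRR|notRR] := boolP ((tp None, tp None) \in A).
  exists (inl ord0, false, p) => u near_u.
  apply: flip_edge (typ_near _ near_u) (typical_fresh _ fresh_p _ _) _ _.
    case: u near_u => [[[i|b] x] q] //; rewrite /near /= => near_i.
    by apply/eqP => -[i0 _ _]; move: near_i; rewrite i0 /=; lia.
  case: u near_u => [[[i|b] x] q] //; rewrite /near /kind /= inRR addbT => near_i.
  by rewrite /ladder_adj; apply/negP => /orP[] /and3P[_ /eqP /=]; lia.
have [inRP|notRP] := boolP ((tp None, tp (Some true)) \in A).
  exists (inr true, false, p) => u near_u.
  apply: flip_edge (typ_near _ near_u) (typical_fresh _ fresh_p _ _) _ _.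
    by case: u near_u => [[[i|b] x] q].
  case: u near_u => [[[i|b] x] q] //; rewrite /near /kind /= inRP addbT => near_i.
  by rewrite /ladder_adj orbF; apply/negP => /andP[/orP[]/andP[]]; lia.
exists (inr true, false, p) => -[[[i|b] x] q] //; rewrite /near /= => near_i.
apply: connect_trans (core_connect x).
apply: (@connect_trans _ _ (inl ord0, x, p)); last first.
  apply: flip_edge_fresh => //; rewrite /kind //= (negPf notRP).
  by rewrite /ladder_adj /= !eqxx.
(* A step to the other near position [j] and a step back turn the label [q] into [p]. *)
have [j [near_j ij]] : exists j : 'I_M.+2,
    ((j == m :> nat) || (j == m.+1 :> nat)) /\
    ((j == i.+1 :> nat) || (i == j.+1 :> nat)).
  by case/orP: near_i => /eqP i_m; [exists (inord m.+1) | exists (inord m)];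
    rewrite inordK; lia.
have neq_ij : i != j by apply/eqP => eq_ij; move: ij; rewrite eq_ij; lia.
case: (i) neq_ij near_i ij => i' lt_i' neq_ij near_i ij.
apply: connect_trans (rung_connect lt_i' x notRR).
apply: (@connect_trans _ _ (inl j, x, (q.1, p.2))).
  apply: flip_edge; rewrite /kind /= ?(negPf notRR) ?addbF; try exact: typ_near.
    by apply: contra neq_ij => /eqP[->].
  by rewrite /ladder_adj /= /share !eqxx !orTb /= !andbT.
apply: flip_edge; rewrite /kind /= ?(negPf notRR) ?addbF.
- exact: typ_near.
- exact: typical_fresh.
- by apply: contra neq_ij => /eqP[->].
- by rewrite /ladder_adj /= /share !eqxx !orbT /= !andbT orbC.
Qed.

End Hub.

(** * Invariance of flip-connectivity formulas *)

Lemma atp_swap c m u (k : nat) (a : k.-tuple ladder_vertex) :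
    m < M.+1 -> (forall i, ~~ near m (tnth a i)) ->
  @atp _ (ladder (~~ c)) _ [tuple of swap m u :: [tuple of map (swap m) a]] =
  @atp _ (ladder c) _ [tuple of u :: a].
Proof.
move=> lt_m far_a; rewrite -map_cons_tuple.
apply: (@atp_map _ (ladder c) (ladder (~~ c))) => [|q v|i j] /=.
- exact: inv_inj (swapK m).
- by rewrite kind_swap.
- case: (tnth_cons_cases u a i) => [|[i']] ->; last first.
    by apply: ladder_adj_swap; rewrite ?(negPf (far_a _)).
  case: (tnth_cons_cases u a j) => [|[j']] ->; first by rewrite !ladder_adj_irr.
  by apply: ladder_adj_swap; rewrite ?(negPf (far_a _)) ?andbF.
Qed.

Lemma flip_swap c m (k : nat) (A : flip_spec bool k)
    (a : k.-tuple ladder_vertex) u v :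
    m < M.+1 -> (forall i, ~~ near m (tnth a i)) -> ~~ (near m u && near m v) ->
  @flip _ (ladder (~~ c)) _ A [tuple of map (swap m) a] (swap m u) (swap m v) =
  @flip _ (ladder c) _ A a u v.
Proof.
move=> lt_m far_a far_uv; rewrite /flip !atp_swap //=.
by rewrite ladder_adj_swap // (inj_eq (inv_inj (swapK m))).
Qed.

(** A flip edge with an end not near [m] is kept by the swap; if both ends are near, their images
    are connected through the hub. *)
Lemma connect_swap c lo hi m (k : nat) (A : flip_spec bool k)
    (a : k.-tuple ladder_vertex) u v :
    k <= M -> 0 < lo -> lo < m -> m.+2 < hi -> hi <= M.+1 ->
    (forall j, outside lo hi (tnth a j)) ->
  connect (@flip _ (ladder c) _ A a) u v ->
  connect (@flip _ (ladder (~~ c)) _ A [tuple of map (swap m) a])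
    (swap m u) (swap m v).
Proof.
move=> le_kM lo_gt0 lo_m m_hi hi_le out; apply: connect_transfer => {}u {}v uv.
have far_a i : ~~ near m (tnth a i) by rewrite (outside_near _ _ (out i)) //; lia.
have lt_m : m < M.+1 by lia.
have [/andP[near_u near_v]|far_uv] := boolP (near m u && near m v); last first.
  by rewrite connect1 // flip_swap.
pose a' : k.-tuple (ladder (~~ c)) := [tuple of map (swap m) a].
have [p fresh_p] := fresh_label_exists a' le_kM.
have [|h hub] :=
    @gap_hub (~~ c) k A a' p fresh_p lo hi m lo_gt0 lo_m m_hi hi_le.
  by move=> j; rewrite tnth_map outside_swap.
apply: connect_trans (hub _ _) _; first by rewrite near_swap.
rewrite (sym_connect_sym (flip_symmetric A a')); apply: hub.
by rewrite near_swap.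
Qed.

(** The bound by [M] provides fresh labels. Any place [m] in the gap is allowed, as all of them act
    alike on pebbles outside it. *)
Definition swap_invariant (n : nat) (f : flogic bool n) : Prop :=
  forall c lo hi m (e : n.-tuple ladder_vertex),
    cost f <= M -> cost f <= hi - lo ->
    0 < lo -> lo < m -> m.+2 < hi -> hi <= M.+1 ->
    (forall i, outside lo hi (tnth e i)) ->
  @flogic_sat _ (ladder (~~ c)) _ f [tuple of map (swap m) e] =
  @flogic_sat _ (ladder c) _ f e.

Lemma sub_gap g lo hi u : 4 <= g -> g.*2.+1 <= hi - lo ->
  exists lo' hi', [/\ lo <= lo', hi' <= hi, g <= hi' - lo' & outside lo' hi' u].
Proof.
case: u => [[[i|b] x] p] g4 le_g; last by exists lo, hi; split=> //; lia.
have [le_gi|lt_ig] := leqP (lo + g) i.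
  by exists lo, (minn i hi); rewrite /outside /=; split; lia.
by exists (maxn i.+1 lo), hi; rewrite /outside /=; split; lia.
Qed.

(* The reply to a pebble placed in the current gap swaps at a point of the
   longer of the two halves left free by that pebble. *)
Lemma swap_invariant_cons (n : nat) (f : flogic bool n.+1) c lo hi m
    (e : n.-tuple ladder_vertex) v :
    swap_invariant f -> (cost f).*2.+1 <= M -> (cost f).*2.+1 <= hi - lo ->
    0 < lo -> lo < m -> m.+2 < hi -> hi <= M.+1 ->
    (forall i, outside lo hi (tnth e i)) ->
  exists m', forall w, w \in [:: v; swap m' v] ->
  @flogic_sat _ (ladder (~~ c)) _ f
    [tuple of swap m' w :: [tuple of map (swap m) e]] =
  @flogic_sat _ (ladder c) _ f [tuple of w :: e].
Proof.
move=> IHf le_M le_gap lo_gt0 lo_m m_hi hi_le out.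
have cost4 := cost_ge4 f.
have [lo' [hi' [lo_lo' hi'_hi le_gap' out_v]]] := sub_gap v cost4 le_gap.
(* Swapping keeps positions, so one place serves [v] and its image, as the two directions of a
   quantifier require. *)
exists lo'.+1 => w wv.
rewrite (_ : [tuple of map (swap m) e] = [tuple of map (swap lo'.+1) e]); last first.
  apply: eq_from_tnth => i; rewrite !tnth_map.
  by apply: swap_outside (out i); lia.
rewrite -map_cons_tuple (IHf _ lo' hi') //; try lia.
move=> i; case: (tnth_cons_cases w e i) => [|[j]] ->.
  by move: wv; rewrite !inE => /orP[]/eqP-> //; rewrite outside_swap.
have := out j; case: (tnth e j) => [[[l|b] x] p] //; rewrite /outside /=; lia.
Qed.

Lemma flogic_sat_swap (n : nat) (f : flogic bool n) : swap_invariant f.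
Proof.
elim: f => [{}n x y|{}n x y|{}n q x|{}n k A s t a|{}n f IHf
    |{}n f IHf g IHg|{}n f IHf g IHg|{}n f IHf|{}n f IHf]
    c lo hi m e /= le_M le_gap
    lo_gt0 lo_m m_hi hi_le out.
- by rewrite !tnth_map (inj_eq (inv_inj (swapK m))).
- rewrite !tnth_map; apply: ladder_adj_swap; first lia.
  by rewrite (outside_near _ _ (out x)) //; lia.
- by rewrite tnth_map kind_swap.
- have def_a (e' : n.-tuple ladder_vertex) (b : k.-tuple 'I_n) :
    [tuple of map (tnth [tuple of map (swap m) e']) b] =
    [tuple of map (swap m) [tuple of map (tnth e') b]].
    by apply: eq_from_tnth => i; rewrite !tnth_map.
  rewrite def_a !tnth_map; set a' := [tuple of map _ a].
  have out_a' j : outside lo hi (tnth a' j) by rewrite tnth_map.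
  have le_kM : k <= M by lia.
  apply/idP/idP; last exact: connect_swap out_a'.
  have out_sa' j : outside lo hi (tnth [tuple of map (swap m) a'] j).
    by rewrite tnth_map outside_swap.
  move/(connect_swap le_kM lo_gt0 lo_m m_hi hi_le out_sa').
  rewrite negbK !swapK (_ : [tuple of map _ [tuple of map _ a']] = a') //.
  by apply: eq_from_tnth => i; rewrite !tnth_map swapK.
- by rewrite (IHf c lo hi).
- by rewrite (IHf c lo hi) ?(IHg c lo hi) //; lia.
- by rewrite (IHf c lo hi) ?(IHg c lo hi) //; lia.
- have step v :=
    swap_invariant_cons c v IHf le_M le_gap lo_gt0 lo_m m_hi hi_le out.
  apply/existsP/existsP => -[v sat_v]; have [m' eq_sat] := step v.
    by exists (swap m' v); rewrite -eq_sat ?swapK // !inE eqxx orbT.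
  by exists (swap m' v); rewrite eq_sat // !inE eqxx.
- have step v :=
    swap_invariant_cons c v IHf le_M le_gap lo_gt0 lo_m m_hi hi_le out.
  apply/forallP/forallP => sat_all v; have [m' eq_sat] := step v.
    by rewrite -eq_sat // !inE eqxx.
  by rewrite -[v](swapK m') eq_sat // !inE eqxx orbT.
Qed.

End TwistedLadder.

(** * The separating low rank MSO sentence *)

(** On the ladders, this says that P-Q pairs across the cut point out of [X] and that no other edge
    crosses it. *)
Definition oriented_cut (G : cgraph bool) (X : {set G}) : Prop :=
  [/\ exists2 u, color true u & u \in X,
      exists2 u, color true u & u \notin X &
      forall u v, u \in X -> v \notin X ->
        adj u v = color true u && color false v].

Definition oriented_cut_formula : lrmso bool 0 1 :=
  let X : 'I_1 := ord0 in
  let u : 'I_2 := ord_max in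
  let v : 'I_2 := ord0 in
  let edge := LAdj bool 1 u v in
  let oriented := LAnd (LCol 1 true u) (LCol 1 false v) in
  LAnd (LEx (LAnd (LCol 1 true (ord0 : 'I_1)) (LMem bool ord0 X)))
  (LAnd (LEx (LAnd (LCol 1 true (ord0 : 'I_1)) (LNot (LMem bool ord0 X))))
  (LAll (LAll
    (LOr (LOr (LNot (LMem bool u X)) (LMem bool v X))
         (LOr (LAnd edge oriented) (LAnd (LNot edge) (LNot oriented))))))).

Definition oriented_cut_sentence : lrmso_sentence bool :=
  LExSet 1 oriented_cut_formula.

Lemma oriented_cut_sentenceP (G : cgraph bool) :
  reflect (exists2 X : {set G}, cut_rank X <= 1 & oriented_cut X)
    (lrmso_models G oriented_cut_sentence).
Proof.
pose oriented (X : {set G}) u v := ((u \notin X) || (v \in X)) ||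
  (adj u v && (color true u && color false v) ||
   ~~ adj u v && ~~ (color true u && color false v)).
have orientedP (X : {set G}) u v : reflect
    (u \in X -> v \notin X -> adj u v = color true u && color false v)
    (oriented X u v).
  rewrite /oriented; case: (u \in X); last by constructor.
  case: (v \in X); first by constructor.
  by case: (adj u v); case: (_ && _) => /=; constructor=> // /(_ isT isT).
apply: (iffP existsP) => -[X]; last first.
  move=> rX [[u Pu Xu] [v Pv Xv] adjX]; exists X; rewrite rX /=.
  apply/and3P; split.
  - by apply/existsP; exists u; apply/andP.
  - by apply/existsP; exists v; apply/andP.
  - by apply/forallP => u'; apply/forallP => v'; apply/orientedP/adjX.
case/andP=> rX /and3P[/existsP[u /andP[Pu Xu]] /existsP[v /andP[Pv Xv]] adjX].
exists X => //; split; [by exists u | by exists v | move=> u' v'].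
by apply/orientedP; apply: (forallP (forallP adjX u') v').
Qed.

Lemma ladder_oriented_cut (M : nat) :
  lrmso_models (ladder M false) oriented_cut_sentence.
Proof.
apply/oriented_cut_sentenceP.
pose X : {set ladder M false} := [set u | ~~ u.1.2].
have cutE (u v : ladder M false) :
    u \in X -> v \notin X -> adj u v = color true u && color false v.
  rewrite !inE negbK; case: u v => [[[i|[]] x] p] [[[j|[]] y] q];
    rewrite /= /ladder_adj /kind /=; case: x => // _; case: y => // _;
    by rewrite ?andbF.
exists X.
  (* The cut matrix is the indicator column of P times the indicator row of Q. *)
  rewrite /cut_rank (_ : cut_mx X =
    (\col_i (color true (enum_val i))%:R
     *m \row_j (color false (enum_val j))%:R)%R).
    exact: mulmx_max_rank.
  apply/matrixP => i j; rewrite !mxE big_ord1 !mxE cutE ?mulnb -?GRing.natrM ?mulnb //.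
    exact: enum_valP.
  by have := enum_valP j; rewrite inE.
pose z : 'I_(width M) := Ordinal (isT : 0 < width M).
pose p : label M := (z, [tuple z | _ < M.+1]).
split=> //.
- by exists (inr true, false, p); rewrite ?inE.
- by exists (inr true, true, p); rewrite ?inE.
Qed.

(** [X] would be closed under the reversed orientation and under ladder edges. The former links all
    P vertices of a sheet, the latter link the two sheets through the twist. *)
Lemma ladder_no_oriented_cut (M : nat) :
  ~~ lrmso_models (ladder M true) oriented_cut_sentence.
Proof.
apply/oriented_cut_sentenceP => -[X _ [[u Pu Xu] [v Pv Xv] cutX]].
have step (w w' : ladder_vertex M) : ladder_adj true w w' !=
    (kind w == Some true) && (kind w' == Some false) -> w \in X -> w' \in X.
  by move=> ne Xw; apply: contraNT ne => Xw'; apply/eqP/cutX.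
have hop x (p q : label M) (z : 'I_(width M)) :
    (z \in p.2) = ~~ x -> (z \in q.2) = x ->
  (inr true, x, p) \in X -> (inr true, x, q) \in X.
  move=> zp zq; pose w : ladder_vertex M := (inr false, x, (z, p.2)).
  move=> Xp; apply: (step w); last apply: (step (inr true, x, p)) => //.
    by rewrite /ladder_adj /kind /= eqxx zq; case: (x).
  by rewrite /ladder_adj /kind /= eqxx zp; case: (x).
have core_closed x (p q : label M) :
    (inr true, x, p) \in X -> (inr true, x, q) \in X.
  have in_p (r : label M) : exists z, z \in r.2.
    by exists (thead r.2); apply: mem_tnth.
  have notin_p (r : label M) z : exists2 z', z' \notin r.2 & z' != z.
    have /exists_notin[z'] : size (z :: r.2) < #|'I_(width M)|.
      by rewrite /= size_tuple card_ord /width; nia.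
    by rewrite inE negb_or => /andP[]; exists z'.
  (* Two hops suffice, the middle P vertex having a constant list. *)
  case: x => Xp.
    have [z' z'q] := in_p q; have [z zp neq_z] := notin_p p z'.
    apply: (hop true (z, [tuple z | _ < M.+1]) _ z') => //=.
      by apply/mapP => -[_ _ eq_z]; rewrite eq_z eqxx in neq_z.
    apply: (hop true p _ z) => //=; first exact: negPf.
    by apply/mapP; exists ord0; rewrite ?mem_enum.
  have [z zp] := in_p p; have [z' z'q neq_z] := notin_p q z.
  apply: (hop false (z, [tuple z' | _ < M.+1]) _ z') => /=.
  - by apply/mapP; exists ord0; rewrite ?mem_enum.
  - exact: negPf.
  apply: (hop false p _ z) => //=.
  by apply/mapP => -[_ _ eq_z]; rewrite eq_z eqxx in neq_z.
have edge w w' : kind w = None -> ladder_adj true w w' -> (w \in X) = (w' \in X).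
  move=> kind_w ww'; apply/idP/idP; apply: step; first by rewrite kind_w ww'.
  by rewrite kind_w andbF ladder_adj_sym ww'.
have twist p : ((inr true, false, p) \in X) = ((inr true, true, p) \in X).
  rewrite -(edge (inl ord_max, false, p) (inr true, true, p)) //; last first.
    by rewrite /ladder_adj /= !eqxx.
  have rungs (i : nat) (lt_i : i < M.+2) :
      ((inl (Ordinal lt_i), false, p) \in X) = ((inr true, false, p) \in X).
    elim: i lt_i => [|i IHi] lt_i.
      by apply: edge => //; rewrite /ladder_adj /= !eqxx.
    rewrite -(IHi (ltnW lt_i)); apply: edge => //.
    by rewrite /ladder_adj /= /share !eqxx !orbT.
  by rewrite -(rungs M.+1 (ltnSn _)); congr ((inl _, _, _) \in X); apply: val_inj.
case: u Pu Xu => [[[i|[]] x] p] //= _ Xu; case: v Pv Xv => [[[j|[]] y] q] //= _.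
case/negP; apply: (core_closed y p); move: Xu.
by case: x; case: y; rewrite ?twist.
Qed.

(** * Inexpressibility *)

Theorem theorem1p2 :
  exists (U : finType) (phi : lrmso_sentence U),
    forall psi : flogic_sentence U,
      ~ (forall G : cgraph U, lrmso_models G phi <-> flogic_models G psi).
Proof.
exists bool, oriented_cut_sentence => psi equiv.
pose M := (cost psi).+1; have cost4 := cost_ge4 psi.
have /equiv psi_true := ladder_oriented_cut M.
have /negP := ladder_no_oriented_cut M; apply; apply/equiv.
move: psi_true; rewrite /flogic_models.
(* With no pebbles placed, the gap from 1 to [M.+1] is free and longer than [cost psi]. *)
rewrite -(@flogic_sat_swap M _ psi false 1 M.+1 2) //; try (rewrite /M; lia).
  by congr (is_true (flogic_sat _ _)); apply: val_inj.
by case.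
Qed.
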